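(* The optimal solution of an instance of the budget-constrained maximal covering location problem with customer preference ordering (BMCLPCP) can be found by solving an instance of the budget-constrained maximal covering location problem (BMCLP). Consequently, also the optimal solution of an instance of the maximal covering location problem with customer preference ordering (MCLPCP) can be obtained by solving an instance of the maximal covering location problem (MCLP).
   Context: **BMCLP (budget-constrained maximal covering location problem).** Let $\mathcal I$ be the set of potential facility locations, and $\mathcal J$ be the set of customers with demands $\mathcal D_j$, $j\in\mathcal J$. Let $\mathcal I(j)\subseteq\mathcal I$ represent the set of facility locations which can cover customer $j$. For each facility location $i\in\mathcal I$, the cost $d_i$ of opening facility $i$ is given. Let $\mathcal B$ be the budget for opening facilities at some of the locations from $\mathcal I$. The goal is to open some of the facilities of $\mathcal I$ respecting the budget $\mathcal B$ (i.e., the sum of the costs of the opened facilities is not allowed to exceed $\mathcal B$) in such a way that the sum of the demands of customers covered by the opened facilities is maximized. A customer $j$ is covered by the opened facilities if at least one facility in $\mathcal I(j)$ is opened. **MCLP (maximal covering location problem).** The version of the BMCLP with a cardinality constraint, given by a number $p$ of facilities to open, instead of the budget constraint. It is the special case of the BMCLP in which $d_i=1$ for all $i\in\mathcal I$ and $\mathcal B=p$. **BMCLPCP (budget-constrained maximal covering location problem with customer preference ordering).** Let $I_1$ be the set of potential locations to open facilities of the company entering the market and $I_2$ be the set of existing facility locations belonging to competitors (these existing facilities are all open), while $I=I_1\cup I_2$. For each facility location $i\in I_1$, the cost $c_i$ of opening this facility is given. The set of customers is $J$. A demand $D_j$ is assigned to each customer $j\in J$, while $I(j)\subseteq I$ represents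 the subset of facility locations that can cover customer $j$. The preference of customer $j\in J$ toward a facility at $i\in I$ is given by $g_{ij}$: if $g_{i_1j}>g_{i_2j}$ holds, customer $j$ prefers to be allocated to a facility on site $i_1$ over a facility on site $i_2$. It is assumed that the preferences of a customer $j$ induce a strict total order of the facility locations that cover $j$, i.e., $g_{i_1j}\neq g_{i_2j}$ for all $i_1\neq i_2\in I(j)$. The company that plans to enter the market has a limited budget $B$ for opening facilities at some of the locations from $I_1$. The goal of the company is to open some facilities $S\subseteq I_1$ respecting the budget $B$ (i.e., $\sum_{i\in S}c_i\le B$) in such a way that the sum of the demands of customers allocated to $S$ is maximized, where a customer $j$ is only allocated to an open facility $i$ from $S$ if - $i\in I(j)$ (i.e., $j$ is covered by $i$), - $g_{ij}\geq g_{i'j}$ for all $i'\in S\cap I(j)$ (i.e., $i$ is the most preferred facility that covers $j$ within $S$), and - $g_{ij}>g_{i'j}$ for all $i'\in I_2\cap I(j)$ (i.e., $j$ is not covered by a more preferred facility $i'$ in $I_2$). **MCLPCP (maximal covering location problem with customer preference ordering).** The version of the BMCLPCP in which a maximum cardinality $p$ of facilities to open is given instead of the costs $c_i$ and the budget $B$. It is the special case of the BMCLPCP in which all opening costs $c_i$ are equal to $1$ and $B=p$. *)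

(* Defs.v *)
From mathcomp Require Import all_boot all_order all_algebra.

Set Implicit Arguments.
Unset Strict Implicit.
Unset Printing Implicit Defensive.

Import Order.TTheory GRing.Theory Num.Theory.
Local Open Scope ring_scope.

(* Locations range over an ambient finite type [L], in which the location sets
   of an instance are subsets; [J] is the set of customers.  Costs and
   preferences are total functions on [L], but only their values on the
   instance's locations matter. *)

Record bmclp (R : realDomainType) (L J : finType) := Bmclp {
  bm_loc : {set L};
  bm_demand : J -> R;
  bm_cover : J -> {set L};
  bm_cost : L -> R;
  bm_budget : R;
  bm_cover_sub : forall j, bm_cover j \subset bm_loc
}.

(* [cp_new] and [cp_old] are the entrant's potential locations I_1 and the
   competitors' existing locations I_2; they are not required to be disjoint. *)
Record bmclpcp (R : realDomainType) (L J : finType) := Bmclpcp {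
  cp_new : {set L};
  cp_old : {set L};
  cp_demand : J -> R;
  cp_cover : J -> {set L};
  cp_pref : L -> J -> R;
  cp_cost : L -> R;
  cp_budget : R;
  cp_cover_sub : forall j, cp_cover j \subset cp_new :|: cp_old;
  cp_pref_strict : forall j i1 i2,
    i1 \in cp_cover j -> i2 \in cp_cover j -> i1 != i2 ->
    cp_pref i1 j != cp_pref i2 j
}.

Section Problems.
Variables (R : realDomainType) (L J : finType).

Section BMCLP.
Variable Q : bmclp R L J.
Implicit Types S : {set L}.

Definition bm_feasible S : bool :=
  (S \subset bm_loc Q) && (\sum_(i in S) bm_cost Q i <= bm_budget Q).

Definition bm_covered S (j : J) : bool :=
  [exists i in bm_cover Q j, i \in S].

Definition bm_value S : R := \sum_(j | bm_covered S j) bm_demand Q j.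

Definition bm_optimal S : Prop :=
  bm_feasible S /\ forall S', bm_feasible S' -> bm_value S' <= bm_value S.

Definition is_mclp (p : nat) : Prop :=
  {in bm_loc Q, forall i, bm_cost Q i = 1} /\ bm_budget Q = p%:R.

End BMCLP.

Section BMCLPCP.
Variable P : bmclpcp R L J.
Implicit Types S : {set L}.

Definition cp_feasible S : bool :=
  (S \subset cp_new P) && (\sum_(i in S) cp_cost P i <= cp_budget P).

Definition cp_allocated S (j : J) (i : L) : bool :=
  [&& i \in S,
      i \in cp_cover P j,
      [forall i' in S :&: cp_cover P j, cp_pref P i j >= cp_pref P i' j]
    & [forall i' in cp_old P :&: cp_cover P j,
         cp_pref P i j > cp_pref P i' j]].

Definition cp_value S : R :=
  \sum_(j | [exists i, cp_allocated S j i]) cp_demand P j.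

Definition cp_optimal S : Prop :=
  cp_feasible S /\ forall S', cp_feasible S' -> cp_value S' <= cp_value S.

Definition is_mclpcp (p : nat) : Prop :=
  {in cp_new P, forall i, cp_cost P i = 1} /\ cp_budget P = p%:R.

End BMCLPCP.

(* What it means to solve [P] by solving [Q].  Only the covering sets of [Q]
   are free: with arbitrary data, one could build [Q] from an optimal solution
   of [P] and the notion would be void. *)
Definition solved_by (P : bmclpcp R L J) (Q : bmclp R L J) : Prop :=
  [/\ [/\ bm_loc Q = cp_new P,
          bm_demand Q =1 cp_demand P,
          {in cp_new P, bm_cost Q =1 cp_cost P}
        & bm_budget Q = cp_budget P],
      forall S, bm_feasible Q S = cp_feasible P S,
      forall S : {set L}, S \subset cp_new P -> bm_value Q S = cp_value P S
    & forall S, bm_optimal Q S <-> cp_optimal P S].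

End Problems.

(* Main.v *)
Require Import Defs.
From mathcomp Require Import all_boot all_order all_algebra.

(** From the point of view of the entrant, competition only filters coverage.
    A customer [j] is won by [S] when the facility of [S] that [j] prefers,
    among those covering [j], beats every competitor covering [j].  It does so
    as soon as some facility of [S] covering [j] does, because preferences are
    transitive; so [j] is won exactly when [S] meets the set of locations that
    cover [j] and beat all competitors covering [j].  That set consists of new
    locations and does not depend on [S]; taking it as the covering set of [j]
    ([captureP]) turns the problem with preferences into a covering problem
    with the same locations, demands, costs and budget.  Both problems then
    have the same feasible sets and the same objective, hence the same
    optimal solutions; unit costs and a cardinality bound are inherited. *)

Set Implicit Arguments.
Unset Strict Implicit.
Unset Printing Implicit Defensive.

Import Order.TTheory.
Local Open Scope ring_scope.

Section Reduction.
Variables (R : realDomainType) (L J : finType) (P : bmclpcp R L J).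
Implicit Types (S : {set L}) (j : J).

Definition captures j : {set L} :=
  [set i in cp_cover P j |
     [forall i' in cp_old P :&: cp_cover P j, cp_pref P i' j < cp_pref P i j]].

(** A competing location covering [j] does not capture [j], since it would have
    to be strictly preferred to itself. *)
Lemma captures_sub j : captures j \subset cp_new P.
Proof.
apply/subsetP=> i; rewrite inE => /andP[covi /forall_inP beati].
case/setUP: (subsetP (cp_cover_sub P j) i covi) => // oldi.
by have := beati i; rewrite inE oldi covi ltxx => /(_ isT).
Qed.

(** The two existentials have different witnesses: a capturing facility of [S]
    need not be the one that [j] is allocated to.  The facility of [S] that [j]
    likes best is at least as preferred, so it beats the competitors too. *)
Lemma captureP S j :
  [exists i in captures j, i \in S] = [exists i, cp_allocated P S j i].
Proof.
apply/exists_inP/existsP => [[i0] | [i]].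
  rewrite inE => /andP[cov0 /forall_inP beat0] Si0.
  have SI0 : i0 \in S :&: cp_cover P j by rewrite inE Si0.
  case: (@arg_maxP _ _ _ i0 (mem (S :&: cp_cover P j)) (cp_pref P ^~ j) SI0).
  move=> i /setIP[Si covi] max_i; exists i; rewrite /cp_allocated Si covi /=.
  apply/andP; split; first by apply/forall_inP.
  apply/forall_inP => i' /beat0 lt_i'0.
  exact: lt_le_trans lt_i'0 (max_i _ SI0).
by case/and4P=> Si covi _ beati; exists i; rewrite // inE covi.
Qed.

Definition capture_problem : bmclp R L J :=
  Bmclp (cp_demand P) (cp_cost P) (cp_budget P) captures_sub.

Lemma capture_value S : bm_value capture_problem S = cp_value P S.
Proof. by apply: eq_bigl => j; apply: captureP. Qed.

Lemma capture_solves : solved_by P capture_problem.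
Proof.
split=> // [S _|S]; first exact: capture_value.
split=> -[feasS optS]; split=> // S' feasS'.
  by rewrite -!capture_value; apply: optS.
by rewrite !capture_value; apply: optS.
Qed.

End Reduction.

Theorem theorem3 (R : realDomainType) (L J : finType) :
  (forall P : bmclpcp R L J,
     exists Q : bmclp R L J, solved_by P Q) /\
  (forall (P : bmclpcp R L J) (p : nat), is_mclpcp P p ->
     exists Q : bmclp R L J, is_mclp Q p /\ solved_by P Q).
Proof.
split=> [P | P p unitP]; exists (capture_problem P); first exact: capture_solves.
by split; [exact: unitP | exact: capture_solves].
Qed.
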